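(* Let $m\ge 0$ and $n\ge 1$ be integers. For $0\le s\le m$ define $$P_{m,s}(q)=\frac{\prod_{j=0}^{s}(1-q^{m+1-j})}{(1-q)^{3s}}\sum_{k=0}^{s}\frac{(-1)^{s-k}}{1-q^{m+1-k}}\left[\binom{2m}{k}-\binom{2m}{k-2}\right]\sum_{i=0}^{s-k}\frac{m-k+1}{m-s+1}\binom{m-s+i}{i}\binom{m-k-i}{s-k-i}q^{s-k-i}.$$ Then each $P_{m,s}(q)$ is a polynomial in $\mathbb{Z}[q]$, and $$S_{2m+1,n}(q)=\sum_{k=0}^{m}(-1)^kP_{m,k}(q)\frac{(1-q^n)^{m+1-k}(1-q^{n+1})^{m+1-k}q^{kn}}{(1-q^2)(1-q)^{2m-3k}\prod_{i=0}^{k}(1-q^{m+1-i})}.$$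
   Context: $q$ is an indeterminate and $q^{1/2}$ a fixed formal square root of $q$; identities are identities of rational functions in $q^{1/2}$. For integers $m,n\ge1$, $$S_{m,n}(q)=\sum_{k=1}^{n}\frac{1-q^{2k}}{1-q^2}\left(\frac{1-q^k}{1-q}\right)^{m-1}q^{\frac{m+1}{2}(n-k)}.$$ Binomial coefficients $\binom{a}{b}$ with integers $a,b$ are taken to be $0$ when $b<0$ or when $0\le a<b$. *)

(* Defs.v *)
From mathcomp Require Import all_boot all_order all_algebra.
From mathcomp Require Import fraction.
Set Implicit Arguments. Unset Strict Implicit. Unset Printing Implicit Defensive.
Import Order.TTheory GRing.Theory Num.Theory.
Local Open Scope ring_scope.

(* K = Q(t) realised as the fraction field of Z[t]; t plays the role of q^{1/2}. *)
Definition K := {fraction {poly int}}.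
Definition toK (p : {poly int}) : K := @FracField.tofrac {poly int} p.
Definition qh : K := toK 'X.
Definition q : K := qh ^+ 2.

Definition binz (a : nat) (b : int) : nat :=
  match b with Posz b' => 'C(a, b') | Negz _ => 0%N end.

Definition S (m n : nat) : K :=
  \sum_(1 <= k < n.+1)
     (1 - q ^+ (2 * k)) / (1 - q ^+ 2) * ((1 - q ^+ k) / (1 - q)) ^+ (m - 1)
     * qh ^+ ((m + 1) * (n - k)).

Definition P (m s : nat) : K :=
  (\prod_(0 <= j < s.+1) (1 - q ^+ (m + 1 - j))) / (1 - q) ^+ (3 * s)
  * \sum_(0 <= k < s.+1)
      ((-1) ^+ (s - k) / (1 - q ^+ (m + 1 - k))
       * ((binz (2 * m) k)%:R - (binz (2 * m) (k%:Z - 2))%:R)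
       * \sum_(0 <= i < (s - k).+1)
           ((m - k + 1)%:R / (m - s + 1)%:R
            * ('C(m - s + i, i))%:R * ('C(m - k - i, s - k - i))%:R
            * q ^+ (s - k - i))).

(* Main.v *)
(** Put c_k = C(2m,k) - C(2m,k-2) and y = (1 - x)(1 - qx) with x = q^n. The coefficients of
    (1 - X)^{2m} (1 - X^2) are antisymmetric, so summing geometric series writes
    (1 - q^2)(1 - q)^{2m} S_{2m+1,n} as the sum over k <= m of
    (-1)^k c_k x^k (1 - x^r)(1 - (qx)^r) / (1 - q^r), where r = m+1-k. Each
    (1 - x^r)(1 - (qx)^r) is a combination of the y^u x^{r-u}, 1 <= u <= r, whose coefficients
    satisfy the recurrence of the generating function
    (1 - q z^2) / ((1 - z)(1 - qz))^{u+1}; collecting powers of y gives the formula.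

    For integrality, call f_s the coefficient of y^{m+1-s} x^s. Clearing its denominators, only
    divisibility by a power of 1 - q remains to be shown. The sum over s of
    f_s y^{m+1-s} x^s vanishes at q = 1 to order at least 2m+1 for every n, and y is (1 - q)^2
    times a polynomial with value n(n+1) at q = 1. As the numbers n(n+1) are distinct, every
    lowest-order coefficient vanishes, so f_s has order at least 2s - 1 there. *)
From HB Require Import structures.
Require Import Defs.
From mathcomp Require Import all_boot all_order all_algebra.
From mathcomp Require Import fraction ring zify.
Set Implicit Arguments. Unset Strict Implicit. Unset Printing Implicit Defensive.
Import Order.TTheory GRing.Theory Num.Theory.
Local Open Scope ring_scope.

(** * Expansion of (1 - x^r)(1 - (qx)^r) in powers of y and x *)

Section KeyIdentity.
Variables (R : comNzRingType) (q : R).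

(* Coefficient of z^i in (1 - z)^{-u}; at u = i = 0 the truncated predecessor is harmless. *)
Definition negbin (u i : nat) : nat := 'C((u + i).-1, i).

Lemma negbin0 u : negbin u 0 = 1%N.
Proof. by rewrite /negbin bin0. Qed.

Lemma negbin0S i : negbin 0 i.+1 = 0%N.
Proof. by rewrite /negbin add0n bin_small. Qed.

Lemma negbin1 i : negbin 1 i = 1%N.
Proof. by rewrite /negbin add1n binn. Qed.

Lemma negbinSS u i : negbin u.+1 i.+1 = (negbin u.+1 i + negbin u i.+1)%N.
Proof. by rewrite /negbin !addSn !addnS /= binS addnC. Qed.

(* Coefficient of z^t in (1 - z)^{-u} (1 - q z)^{-v}. *)
Definition conv (u v t : nat) : R :=
  \sum_(i < t.+1) (negbin u i * negbin v (t - i))%:R * q ^+ (t - i).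

Lemma conv0 u v : conv u v 0 = 1.
Proof. by rewrite /conv big_ord1 !negbin0 mulr1. Qed.

Lemma convSl u v t : conv u.+1 v t.+1 = conv u.+1 v t + conv u v t.+1.
Proof.
rewrite /conv big_ord_recl [in RHS](big_ord_recl t.+1) /= !negbin0 addrCA -big_split /=.
congr (_ + _); apply: eq_bigr => i _.
by rewrite /bump leq0n add1n subSS negbinSS mulnDl natrD mulrDl.
Qed.

Lemma convSr u v t : conv u v.+1 t.+1 = q * conv u v.+1 t + conv u v t.+1.
Proof.
rewrite /conv big_ord_recr [in RHS](big_ord_recr t.+1) /= subnn !negbin0 addrA.
congr (_ + _); rewrite mulr_sumr -big_split /=; apply: eq_bigr => i _.
have le_it : (i <= t)%N by rewrite -ltnS.
by rewrite subSn // negbinSS mulnDr natrD exprS; ring.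
Qed.

Lemma conv10 t : conv 1 0 t = 1.
Proof.
case: t => [|t]; first exact: conv0.
rewrite /conv big_ord_recr /= subnn negbin1 negbin0 muln1 expr0 mulr1 big1 ?add0r //.
by move=> i _; rewrite subSn ?leq_ord // negbin0S muln0 mul0r.
Qed.

Lemma conv01 t : conv 0 1 t = q ^+ t.
Proof.
case: t => [|t]; first exact: conv0.
rewrite /conv big_ord_recl /= subn0 negbin1 negbin0 muln1 mul1r big1 ?addr0 //.
by move=> i _; rewrite /bump leq0n add1n negbin0S mul0n mul0r.
Qed.

(* Coefficient of z^t in (1 - q z^2) / ((1 - z)(1 - q z))^{u+1}. *)
Definition acoef (u t : nat) : R :=
  conv u.+1 u t + (if t is t'.+1 then q * conv u u.+1 t' else 0).

Lemma acoef0 u : acoef u 0 = 1.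
Proof. by rewrite /acoef conv0 addr0. Qed.

Lemma acoef0S t : acoef 0 t.+1 = 1 + q ^+ t.+1.
Proof. by rewrite /acoef conv10 conv01 exprS. Qed.

Lemma acoefS1 u : acoef u.+1 1 = acoef u 1 + (1 + q).
Proof. by rewrite /acoef !convSl !convSr !conv0; ring. Qed.

(** Multiplying the generating function by (1 - z)(1 - qz) = 1 - (1 + q)z + qz^2 lowers u by one. *)
Lemma acoefSS u t :
  acoef u.+1 t.+2 = acoef u t.+2 + (1 + q) * acoef u.+1 t.+1 - q * acoef u.+1 t.
Proof.
have E v w s : conv v.+1 w.+1 s.+2 =
    conv v w s.+2 + (1 + q) * conv v.+1 w.+1 s.+1 - q * conv v.+1 w.+1 s.
  have H1 := convSl v w.+1 s.+1; have H2 := convSr v w s.+1.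
  by rewrite H1 H2 (_ : conv v w.+1 s.+1 = conv v.+1 w.+1 s.+1 - conv v.+1 w.+1 s);
     [ring | rewrite (convSl v w.+1 s); ring].
rewrite /acoef (E u.+1 u); case: t => [|t]; last by rewrite (E u u.+1); ring.
by rewrite (convSl u u.+2 0) (convSr u u.+1 0) !conv0; ring.
Qed.

Variable x : R.
Let y : R := (1 - x) * (1 - q * x).

(* The term u = 0, equal to (1 + q^r) x^r for r > 0, makes the recurrence for T homogeneous. *)
Let T (r : nat) : R := \sum_(u < r.+1) acoef u (r - u) * y ^+ u * x ^+ (r - u).

Let U (r : nat) : R := \sum_(u < r) acoef u.+1 (r - u.+1) * y ^+ u.+1 * x ^+ (r - u.+1).

Let TE r : T r = acoef 0 r * x ^+ r + U r.
Proof. by rewrite /T big_ord_recl subn0 expr0 mulr1. Qed.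

(** This is [acoefSS] applied term by term; where it lowers u, a factor y comes out and the sum
    starts at u = 0, hence [T]. *)
Let USS r : U r.+2 = y * T r.+1 + (1 + q) * x * U r.+1 - q * x ^+ 2 * U r.
Proof.
(* The two top terms have second index 1 and 0, out of reach of [acoefSS], so they are split off. *)
have -> : U r.+2 = \sum_(i < r) acoef i.+1 (r.+2 - i.+1) * y ^+ i.+1 * x ^+ (r.+2 - i.+1)
    + acoef r.+1 1 * y ^+ r.+1 * x + y ^+ r.+2.
  by rewrite /U !big_ord_recr /= !subSS subnn subSnn acoef0 expr0 expr1; ring.
have -> : U r.+1 = \sum_(i < r) acoef i.+1 (r.+1 - i.+1) * y ^+ i.+1 * x ^+ (r.+1 - i.+1)
    + y ^+ r.+1.
  by rewrite /U big_ord_recr /= subnn acoef0 expr0; ring.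
have -> : T r.+1 = \sum_(i < r) acoef i (r.+1 - i) * y ^+ i * x ^+ (r.+1 - i)
    + acoef r 1 * y ^+ r * x + y ^+ r.+1.
  by rewrite /T !big_ord_recr /= subnn subSnn acoef0 expr0 expr1; ring.
rewrite acoefS1.
have -> : \sum_(i < r) acoef i.+1 (r.+2 - i.+1) * y ^+ i.+1 * x ^+ (r.+2 - i.+1) =
  y * (\sum_(i < r) acoef i (r.+1 - i) * y ^+ i * x ^+ (r.+1 - i)) +
  (1 + q) * x * (\sum_(i < r) acoef i.+1 (r.+1 - i.+1) * y ^+ i.+1 * x ^+ (r.+1 - i.+1))
  - q * x ^+ 2 * \sum_(u < r) acoef u.+1 (r - u.+1) * y ^+ u.+1 * x ^+ (r - u.+1).
  rewrite !mulr_sumr -big_split -sumrB /=; apply: eq_bigr => i _.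
  have lt_ir := ltn_ord i; rewrite !subSS.
  have -> : (r.+1 - i = (r - i.+1).+2)%N by lia.
  have -> : (r - i = (r - i.+1).+1)%N by lia.
  by rewrite acoefSS !exprS; ring.
by rewrite /U !exprS; ring.
Qed.

(** Since y + (1 + q)x = 1 + qx^2, the recurrence for [T] has characteristic roots 1 and qx^2. As
    [T 0] is 1 and not 2, the induction starts from [T 1] and [T 2]. *)
Let T_closed r : T r.+1 = 1 + q ^+ r.+1 * x ^+ (2 * r.+1).
Proof.
have [] : T r.+1 = 1 + q ^+ r.+1 * x ^+ (2 * r.+1) /\
          T r.+2 = 1 + q ^+ r.+2 * x ^+ (2 * r.+2); last by [].
have T1 : T 1 = 1 + q * x ^+ 2.
  rewrite TE /U big_ord1 acoef0S subnn acoef0 /y; ring.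
elim: r => [|r [IH1 IH2]].
  by split; rewrite ?T1 // TE USS T1 acoef0S /U big_ord1 big_ord0 acoef0 /= /y; ring.
split=> //; rewrite TE USS.
have -> : U r.+2 = T r.+2 - acoef 0 r.+2 * x ^+ r.+2 by rewrite TE; ring.
have -> : U r.+1 = T r.+1 - acoef 0 r.+1 * x ^+ r.+1 by rewrite TE; ring.
rewrite IH1 IH2 !acoef0S !mulnS !exprD !exprS /y.
ring.
Qed.

(** The product is 1 + q^r x^(2r) - (1 + q^r) x^r, that is, [T r] without its term u = 0. *)
Lemma prod_sub_expand r : (0 < r)%N ->
  (1 - x ^+ r) * (1 - (q * x) ^+ r) =
  \sum_(t < r) acoef (r - t) t * ((1 - x) * (1 - q * x)) ^+ (r - t) * x ^+ t.
Proof.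
case: r => // r _.
have -> : \sum_(t < r.+1) acoef (r.+1 - t) t * y ^+ (r.+1 - t) * x ^+ t = U r.+1.
  rewrite /U (reindex_inj rev_ord_inj) /=; apply: eq_bigr => i _.
  by rewrite subSS subSn ?leq_subr // subKn // -ltnS.
have -> : U r.+1 = T r.+1 - acoef 0 r.+1 * x ^+ r.+1 by rewrite TE; ring.
by rewrite T_closed acoef0S exprMn mulnC exprM; ring.
Qed.

(* Identifies acoef with the inner sum over i in P_{m,s}, for u + 1 = m-s+1 and t = s-k. *)
Lemma acoef_scale u t :
  u.+1%:R * acoef u.+1 t =
  \sum_(i < t.+1) ((u.+1 + t) * 'C(u + i, i) * 'C(u + t - i, t - i))%:R * q ^+ (t - i).
Proof.
have E1 j : (u.+1 * negbin u.+2 j = j.+1 * negbin u.+1 j.+1)%N.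
  by rewrite /negbin !addSn !addnS /= mul_bin_left; congr (_ * _)%N; lia.
have E2 j : (u.+1 * negbin u.+2 j = (u.+1 + j) * negbin u.+1 j)%N.
  case: j => [|j]; first by rewrite !negbin0 addn0.
  by rewrite negbinSS mulnDr E1 mulnDl addnC.
have -> : acoef u.+1 t = \sum_(i < t.+1)
    (negbin u.+2 i * negbin u.+1 (t - i)
     + negbin u.+1 i * (if (t - i)%N is j.+1 then negbin u.+2 j else 0))%:R * q ^+ (t - i).
  rewrite /acoef /conv; under [RHS]eq_bigr do rewrite natrD mulrDl.
  rewrite big_split /=; congr (_ + _).
  case: t => [|t]; first by rewrite big_ord1 muln0 mul0r.
  rewrite [RHS]big_ord_recr /= subnn /= muln0 mul0r addr0 mulr_sumr; apply: eq_bigr => i _.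
  by rewrite subSn ?leq_ord // exprS; ring.
rewrite mulr_sumr; apply: eq_bigr => i _; rewrite mulrA -natrM; congr (_%:R * _).
have le_it : (i <= t)%N by rewrite -ltnS.
have -> : ('C(u + i, i) = negbin u.+1 i)%N by [].
have -> : ('C(u + t - i, t - i) = negbin u.+1 (t - i))%N by rewrite /negbin addSn addnBA.
(* The parts u+1+i and t-i of this factor account for the two summands, through [E2] and [E3]. *)
have -> : (u.+1 + t = u.+1 + i + (t - i))%N by lia.
have E3 j : (u.+1 * (if j is j'.+1 then negbin u.+2 j' else 0) = j * negbin u.+1 j)%N.
  by case: j => [|j]; rewrite ?muln0 ?E1.
by rewrite mulnDr mulnA E2 [X in (_ + X)%N]mulnCA E3; lia.
Qed.

End KeyIdentity.

(** * The antisymmetric coefficients of (1 - X)^(2m) (1 - X^2) *)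

Section Binomial.
Variable R : comNzRingType.

(* For k < 2 the index k - 2 is a negative integer, where binz is 0. *)
Definition ccoef (m k : nat) : R :=
  (binz (2 * m) k)%:R - (binz (2 * m) (k%:Z - 2))%:R.

Lemma ccoefE m k : ccoef m k =
  'C(2 * m, k)%:R - (if k is k'.+2 then 'C(2 * m, k') else 0)%:R.
Proof.
rewrite /ccoef; case: k => [|[|k]] //.
by have -> : (k.+2%:Z - 2 = k%:Z) by lia.
Qed.

(** The reflection swaps the two binomials. Both ends of the range are treated apart, because there
    one of the binomials vanishes. *)
Lemma ccoef_sym m k : (k <= 2 * m + 2)%N -> ccoef m (2 * m + 2 - k) = - ccoef m k.
Proof.
move=> le_k; rewrite !ccoefE.
case: k le_k => [|[|k]] le_k.
- by rewrite subn0 addn2 bin_small // binn bin0 subr0 sub0r.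
- have -> : (2 * m + 2 - 1 = (2 * m).+1)%N by lia.
  rewrite bin_small // bin1 subr0 sub0r; case: m le_k => [|m] _; first by rewrite muln0.
  have -> : (2 * m.+1 = (2 * m).+2)%N by lia.
  by rewrite -[in RHS](bin1 (2 * m).+2) -bin_sub ?subSnn.
have -> : (2 * m + 2 - k.+2 = 2 * m - k)%N by lia.
rewrite bin_sub; last by lia.
case E: (2 * m - k)%N => [|[|j]].
- by rewrite (bin_small (m := k.+2)) ?sub0r ?opprK ?subr0 //; lia.
- by rewrite (bin_small (m := k.+2)) ?sub0r ?opprK ?subr0 //; lia.
by rewrite -(bin_sub (m := k.+2)) ?opprB; [congr (_ - _%:R); congr 'C(_, _)|]; lia.
Qed.

Lemma ccoef_expand m (x : R) :
  (1 - x) ^+ (2 * m) * (1 - x ^+ 2) =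
  \sum_(k < 2 * m + 3) (-1) ^+ k * ccoef m k * x ^+ k.
Proof.
have bin_expand : (1 - x) ^+ (2 * m) =
    \sum_(k < 2 * m + 1) (-1) ^+ k * 'C(2 * m, k)%:R * x ^+ k.
  rewrite addn1 exprDn; apply: eq_bigr => i _.
  by rewrite expr1n mul1r -mulr_natr mulrAC -exprNn.
rewrite (eq_bigr (fun k : 'I_(2 * m + 3) => (-1) ^+ k * 'C(2 * m, k)%:R * x ^+ k -
   (-1) ^+ k * (if (k : nat) is k'.+2 then 'C(2 * m, k') else 0)%:R * x ^+ k)); last first.
  by move=> k _; rewrite ccoefE; ring.
rewrite sumrB mulrBr mulr1; congr (_ - _).
  rewrite bin_expand addn1 addn3 [RHS]big_ord_recr [in RHS]big_ord_recr /=.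
  rewrite (bin_small (ltnSn _)) (bin_small (leqW (ltnSn _))).
  by rewrite !(mulr0, mul0r) !addr0.
rewrite bin_expand addn1 addn3 [RHS]big_ord_recl [in RHS]big_ord_recl /= !(mulr0, mul0r) !add0r mulr_suml.
by apply: eq_bigr => i _; rewrite !exprS; ring.
Qed.

Lemma ccoef_expand_fold m (x : R) :
  (1 - x) ^+ (2 * m) * (1 - x ^+ 2) =
  \sum_(k < m.+1) (-1) ^+ k * ccoef m k * (x ^+ k - x ^+ (2 * m + 2 - k)).
Proof.
rewrite ccoef_expand.
have -> : (2 * m + 3 = m.+1 + (1 + m.+1))%N by lia.
rewrite big_split_ord big_split_ord big_ord1 /= addn0.
(* The middle index is its own reflection; its two binomials agree by symmetry, in any
   characteristic. *)
have -> : ccoef m m.+1 = 0.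
  rewrite ccoefE; case: m => [|m]; first by rewrite subr0.
  rewrite -(bin_sub (m := m)); last by lia.
  by rewrite (_ : 2 * m.+1 - m = m.+2)%N ?subrr //; lia.
rewrite mulr0 mul0r add0r [X in _ + X](reindex_inj rev_ord_inj) -big_split /=.
apply: eq_bigr => k _.
have le_k : (k <= m)%N by rewrite -ltnS.
have -> : (m.+1 + (1 + (m.+1 - k.+1)) = 2 * m + 2 - k)%N by lia.
rewrite ccoef_sym; last by lia.
have -> : (-1) ^+ (2 * m + 2 - k) = (-1) ^+ k :> R.
  rewrite (_ : 2 * m + 2 - k = k + 2 * (m.+1 - k))%N; last by lia.
  by rewrite exprD exprM sqrrN !expr1n mulr1.
by ring.
Qed.

End Binomial.

(** * Geometric sums and a triangular reindexing *)

Section Geometric.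
Variables (F : fieldType) (q : F).

Lemma geom_pair r k n : 1 - q ^+ r != 0 ->
  \sum_(1 <= j < n.+1) ((q ^+ j) ^+ k - (q ^+ j) ^+ (k + 2 * r)) * q ^+ ((k + r) * (n - j)) =
  q ^+ (k * n) * ((1 - q ^+ (r * n)) * (1 - q ^+ (r * n.+1))) / (1 - q ^+ r).
Proof.
move=> nz; elim: n => [|n IH].
  by rewrite big_nil !muln0 expr0 subrr mul0r mulr0 mul0r.
rewrite big_nat_recr //= subnn muln0 expr0 mulr1.
(* Passing from n to n+1 multiplies every earlier term by q^(k+r). *)
rewrite (eq_big_nat _ _ (F2 := fun j => q ^+ (k + r) *
   (((q ^+ j) ^+ k - (q ^+ j) ^+ (k + 2 * r)) * q ^+ ((k + r) * (n - j))))); last first.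
  by move=> j /andP[_ lt_j]; rewrite subSn // mulnS [in LHS](exprD q (k + r)) mulrCA.
rewrite -mulr_sumr IH; apply: (mulIf nz); rewrite mulrDl mulrA !(mulfVK nz).
rewrite -!exprM [(n.+1 * k)%N]mulnC [(n.+1 * _)%N]mulnC mulnDl.
have -> : (2 * r * n.+1 = r * n.+1 + r * n.+1)%N by lia.
rewrite !mulnS !exprD.
ring.
Qed.

End Geometric.

Lemma sum_triangle (V : nmodType) (f : nat -> nat -> V) M :
  \sum_(k < M) \sum_(t < M - k) f k t = \sum_(s < M) \sum_(k < s.+1) f k (s - k)%N.
Proof.
elim: M => [|M IH]; first by rewrite !big_ord0.
rewrite big_ord_recr [RHS]big_ord_recr /= -IH [in RHS]big_ord_recr /= addrA -big_split /=.
rewrite subSnn subnn big_ord1; congr (_ + _); apply: eq_bigr => k _.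
by rewrite subSn ?big_ord_recr // ltnW.
Qed.

(** * Divisibility by powers of 1 - X in Z[X] *)

Lemma horner1_eq0 (p : {poly int}) : p.[1] = 0 -> exists r, p = (1 - 'X) * r.
Proof.
move=> p1; have /factor_theorem [r ->] : root p 1 by apply/rootP.
by exists (- r); rewrite mulrN -mulNr opprB mulrC.
Qed.

Lemma one_subX_neq0 : 1 - 'X != 0 :> {poly int}.
Proof. by rewrite -oppr_eq0 opprB -polyC1 polyXsubC_eq0. Qed.

Lemma horner1_one_subX : (1 - 'X : {poly int}).[1] = 0.
Proof. by rewrite -polyC1 hornerD hornerN hornerX hornerC subrr. Qed.

(** A polynomial of size at most N with N distinct roots is zero. *)
Lemma sum_pow_eq0 N (b : nat -> int) (g : 'I_N -> int) : injective b ->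
  (forall n, \sum_j g j * b n ^+ j = 0) -> forall j, g j = 0.
Proof.
move=> inj_b sum0 j.
pose p := \poly_(i < N) (if insub i is Some j then g j else 0).
have pE (i : 'I_N) : p`_i = g i by rewrite coef_poly ltn_ord valK.
suff p0 : p = 0 by rewrite -pE p0 coef0.
apply: (@roots_geq_poly_eq0 _ p [seq b n | n <- iota 0 N]).
- apply/allP => _ /mapP[n _ ->]; apply/rootP; rewrite horner_poly -[RHS](sum0 n).
  by apply: eq_bigr => i _; rewrite valK.
- by rewrite map_inj_uniq ?iota_uniq.
by rewrite size_map size_iota size_poly.
Qed.

(** Induction on e: evaluating at 1 and cancelling [w n] leaves a polynomial in [b n] with
    coefficients G_j(1), so all of these vanish; one factor 1 - X is then divided out of every
    G_j. *)
Lemma one_subX_exp_dvd_coefs N (V : nat -> 'I_N -> {poly int}) (w b : nat -> int)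
    (e : nat) (G : 'I_N -> {poly int}) :
    injective b -> (forall n, w n != 0) -> (forall n j, (V n j).[1] = w n * b n ^+ j) ->
    (forall n, exists r, \sum_j G j * V n j = (1 - 'X) ^+ e * r) ->
  forall j, exists r, G j = (1 - 'X) ^+ e * r.
Proof.
move=> inj_b w_neq0 V1; elim: e G => [|e IH] G sumG j.
  by exists (G j); rewrite mul1r.
have [G' G'E] : exists G' : 'I_N -> {poly int}, forall j, G j = (1 - 'X) * G' j.
  apply: (fin_all_exists (P := fun i p => G i = (1 - 'X) * p)) => i; apply: horner1_eq0.
  apply: (sum_pow_eq0 (g := fun i => (G i).[1]) inj_b) => n; have [r] := sumG n.
  move/(congr1 (horner^~ 1)); rewrite exprS -mulrA hornerM horner1_one_subX mul0r.
  rewrite horner_sum => sum0; apply: (mulfI (w_neq0 n)); rewrite mulr0 mulr_sumr -[RHS]sum0.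
  by apply: eq_bigr => k _; rewrite hornerM V1 mulrCA.
suff [r E] : exists r, G' j = (1 - 'X) ^+ e * r by exists r; rewrite G'E E mulrA -exprS.
apply: IH => n; have [r sumr] := sumG n; exists r; apply: (mulfI one_subX_neq0).
rewrite mulrA -exprS -sumr mulr_sumr; apply: eq_bigr => i _.
by rewrite G'E mulrA.
Qed.

Lemma one_subX_exp_dvd_mul (e : nat) (p d r : {poly int}) : d.[1] != 0 ->
  p * d = (1 - 'X) ^+ e * r -> exists r', p = (1 - 'X) ^+ e * r'.
Proof.
move=> d1 pd.
(* With a single coefficient only the power [b n ^+ 0] = 1 occurs, so any injective [b] serves. *)
apply: (@one_subX_exp_dvd_coefs 1 (fun _ _ => d) (fun=> d.[1]) (fun n => n%:Z) e
          (fun=> p) _ _ _ _ ord0) => //.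
- by move=> m n [].
- by move=> n j; rewrite ord1 mulr1.
by move=> n; exists r; rewrite big_ord1.
Qed.

Definition qint (n : nat) : {poly int} := \sum_(i < n) 'X^i.

Lemma one_subX_qint n : 1 - 'X^n = (1 - 'X) * qint n.
Proof. by rewrite -[LHS]opprB subrX1 -mulNr opprB. Qed.

Lemma horner1_qint n : (qint n).[1] = n%:R.
Proof.
rewrite /qint horner_sum (eq_bigr (fun=> 1)) ?sumr_const ?card_ord // => i _.
by rewrite hornerXn expr1n.
Qed.

(** * The expansion of the power sum over a field *)

Section FaulhaberExpansion.
Variables (F : fieldType) (q : F).
Hypothesis q_neq_root : forall n, (0 < n)%N -> 1 - q ^+ n != 0.

(* Coefficient of ((1 - x)(1 - q x))^{m+1-s} x^s; P_{m,s} is (-1)^s times a rescaling of it. *)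
Definition fcoef (m s : nat) : F :=
  \sum_(k < s.+1) (-1) ^+ k * ccoef F m k / (1 - q ^+ (m.+1 - k))
                  * acoef q (m.+1 - s) (s - k).

(** With r = m+1-k, the exponents paired by [ccoef_expand_fold] are k and k+2r, and the weight
    q^((m+1)(n-j)) is the one in [geom_pair]. Expanding by [prod_sub_expand], the terms are grouped
    by s = k+t. *)
Lemma faulhaber_expand m n :
  \sum_(1 <= j < n.+1) (1 - q ^+ (2 * j)) * (1 - q ^+ j) ^+ (2 * m) * q ^+ (m.+1 * (n - j)) =
  \sum_(s < m.+1) fcoef m s * ((1 - q ^+ n) * (1 - q ^+ n.+1)) ^+ (m.+1 - s) * q ^+ (s * n).
Proof.
transitivity (\sum_(1 <= j < n.+1) \sum_(k < m.+1) (-1) ^+ k * ccoef F m k *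
    (((q ^+ j) ^+ k - (q ^+ j) ^+ (k + 2 * (m.+1 - k))) * q ^+ ((k + (m.+1 - k)) * (n - j)))).
  apply: eq_bigr => j _.
  rewrite [(2 * j)%N]mulnC [q ^+ (j * 2)]exprM [X in X * _]mulrC ccoef_expand_fold mulr_suml.
  apply: eq_bigr => k _; have lt_k := ltn_ord k.
  rewrite (_ : k + 2 * (m.+1 - k) = 2 * m + 2 - k)%N; last by lia.
  by rewrite (_ : k + (m.+1 - k) = m.+1)%N ?mulrA //; lia.
rewrite exchange_big /=.
pose f k t := (-1) ^+ k * ccoef F m k / (1 - q ^+ (m.+1 - k)) * acoef q (m.+1 - k - t) t
  * ((1 - q ^+ n) * (1 - q ^+ n.+1)) ^+ (m.+1 - k - t) * q ^+ ((k + t) * n).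
transitivity (\sum_(k < m.+1) \sum_(t < m.+1 - k) f k t).
  apply: eq_bigr => k _; have lt_k := ltn_ord k.
  have r_gt0 : (0 < m.+1 - k)%N by rewrite subn_gt0.
  rewrite -mulr_sumr geom_pair ?q_neq_root //.
  have := prod_sub_expand q (q ^+ n) r_gt0; rewrite -exprS -!exprM.
  rewrite [(n * _)%N]mulnC [(n.+1 * _)%N]mulnC => ->.
  rewrite mulr_sumr mulr_suml mulr_sumr; apply: eq_bigr => t _.
  by rewrite /f mulnDl exprD -exprM [(n * t)%N]mulnC; ring.
rewrite sum_triangle; apply: eq_bigr => s _; rewrite /fcoef !mulr_suml.
apply: eq_bigr => k _; have le_k : (k <= s)%N by rewrite -ltnS.
have lt_s := ltn_ord s.
by rewrite /f subnKC // (_ : m.+1 - k - (s - k) = m.+1 - s)%N //; lia.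
Qed.

End FaulhaberExpansion.

(** * Integrality, for any embedding of Z[X] into a field *)

Section Integrality.
Variables (F : fieldType) (emb : {rmorphism {poly int} -> F}).
Hypothesis emb_inj : injective emb.
Let q := emb 'X.

Let emb_eq0 p : (emb p == 0) = (p == 0).
Proof. by rewrite -(rmorph0 emb) (inj_eq emb_inj). Qed.

Let emb_one_subX : emb (1 - 'X) = 1 - q.
Proof. by rewrite rmorphB rmorph1. Qed.

Lemma one_sub_emb_exp n : 1 - q ^+ n = (1 - q) * emb (qint n).
Proof. by rewrite -emb_one_subX -rmorphM -one_subX_qint rmorphB rmorph1 rmorphXn. Qed.

Lemma one_sub_emb_neq0 : 1 - q != 0.
Proof. by rewrite -emb_one_subX emb_eq0 one_subX_neq0. Qed.

Lemma emb_qint_neq0 n : (0 < n)%N -> emb (qint n) != 0.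
Proof.
move=> n_gt0; rewrite emb_eq0; apply/eqP => /(congr1 (horner^~ 1)).
by rewrite horner1_qint horner0 => /eqP; rewrite pnatr_eq0 gtn_eqF.
Qed.

Lemma one_sub_emb_exp_neq0 n : (0 < n)%N -> 1 - q ^+ n != 0.
Proof.
by move=> n_gt0; rewrite one_sub_emb_exp (mulf_neq0 one_sub_emb_neq0 (emb_qint_neq0 n_gt0)).
Qed.

Let isq (z : F) := exists p, z = emb p.

Let isq_emb p : isq (emb p). Proof. by exists p. Qed.

Let isq_q : isq q. Proof. exact: isq_emb. Qed.

Let isqD x y : isq x -> isq y -> isq (x + y).
Proof. by move=> [p ->] [r ->]; exists (p + r); rewrite rmorphD. Qed.

Let isqB x y : isq x -> isq y -> isq (x - y).
Proof. by move=> [p ->] [r ->]; exists (p - r); rewrite rmorphB. Qed.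

Let isqM x y : isq x -> isq y -> isq (x * y).
Proof. by move=> [p ->] [r ->]; exists (p * r); rewrite rmorphM. Qed.

Let isq_nat n : isq n%:R.
Proof. by exists n%:R; rewrite rmorph_nat. Qed.

Let isqX x n : isq x -> isq (x ^+ n).
Proof. by move=> [p ->]; exists (p ^+ n); rewrite rmorphXn. Qed.

Let isq_sum (I : finType) (f : I -> F) : (forall i, isq (f i)) -> isq (\sum_i f i).
Proof.
by move=> isq_f; apply: (big_ind isq) => //; exists 0; rewrite rmorph0.
Qed.

(* Dividing by f k cancels a factor of the product, so no denominator is left. *)
Let isq_prod_div N (f : nat -> F) (k : 'I_N) : (forall j, isq (f j)) -> f k != 0 ->
  isq ((\prod_(j < N) f j) / f k).
Proof.
move=> isq_f fk; rewrite (bigD1 k) //= mulrC mulKf //.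
by apply: (big_ind isq) => //; exists 1; rewrite rmorph1.
Qed.

Let isq_acoef u t : isq (acoef q u t).
Proof.
have isq_conv v w r : isq (conv q v w r).
  by apply: isq_sum => i; apply: isqM; [apply: isq_nat | apply: isqX].
rewrite /acoef; apply: isqD; first exact: isq_conv.
by case: t => [|t]; [apply: (isq_nat 0) | apply: isqM].
Qed.

Let isq_fcoef_mul m s z : (forall k : 'I_s.+1, isq (z / (1 - q ^+ (m.+1 - k)))) ->
  isq (z * fcoef q m s).
Proof.
move=> isq_z; rewrite /fcoef mulr_sumr; apply: isq_sum => k.
have -> : z * ((-1) ^+ k * ccoef F m k / (1 - q ^+ (m.+1 - k)) * acoef q (m.+1 - s) (s - k)) =
   z / (1 - q ^+ (m.+1 - k)) * ((-1) ^+ k * ccoef F m k * acoef q (m.+1 - s) (s - k)) by ring.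
apply: isqM => //; apply: isqM => //; apply: isqM.
  by apply: isqX; exists (- 1); rewrite rmorphN1.
by apply: isqB; apply: isq_nat.
Qed.

(** The multiplier clears each 1 - q^(m+1-k) and is the same for all s, so the linear relation among
    the [fcoef q m s] is kept. *)
Let cleared m s := (1 - q) * (\prod_(j < m.+1) emb (qint (m.+1 - j))) * fcoef q m s.

Let isq_cleared m s : (s <= m)%N -> isq (cleared m s).
Proof.
move=> le_sm; apply: isq_fcoef_mul => k.
have lt_k : (k < m.+1)%N by rewrite ltnS (leq_trans _ le_sm) // -ltnS.
rewrite one_sub_emb_exp -mulf_div divff ?one_sub_emb_neq0 // mul1r.
apply: (isq_prod_div (f := fun j => emb (qint (m.+1 - j))) (k := Ordinal lt_k)) => //=.
by rewrite emb_qint_neq0 // subn_gt0.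
Qed.

Let isq_numerator m s : (s <= m)%N ->
  isq ((\prod_(j < s.+1) (1 - q ^+ (m.+1 - j))) * fcoef q m s).
Proof.
move=> le_sm; apply: isq_fcoef_mul => k.
apply: (isq_prod_div (f := fun j => 1 - q ^+ (m.+1 - j))) => [j|].
  by apply: isqB; [apply: (isq_nat 1) | apply: isqX].
by rewrite one_sub_emb_exp_neq0 // subn_gt0 ltnS (leq_trans _ le_sm) // -ltnS.
Qed.

Let cleared_dvd m (G : nat -> {poly int}) :
    (forall s, (s <= m)%N -> cleared m s = emb (G s)) ->
  forall s, (s <= m)%N -> exists r, G s = (1 - 'X) ^+ (2 * s) * r.
Proof.
move=> GE s le_sm.
(* At x = q^(n+1) and s = m-j, this is y^(m+1-s) x^s without its factor (1 - q)^(2(j+1)), which goes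
   into [H]. Starting at n+1 keeps [b n] nonzero; since the power is j+1, [b] also serves as [w]. *)
pose V n (j : 'I_m.+1) := (qint n.+1 * qint n.+2) ^+ j.+1 * 'X^((m - j) * n.+1).
pose H (j : 'I_m.+1) := G (m - j)%N * (1 - 'X) ^+ (2 * j.+1).
pose b n : int := (n.+1 * n.+2)%:Z.
have b_inj : injective b by move=> n1 n2 [] /eqP; rewrite /b; nia.
have [||n|r] := @one_subX_exp_dvd_coefs m.+1 V b b (2 * m.+1) H b_inj _ _ _
                  (inord (m - s)).
- by [].
- move=> n j; rewrite /V hornerM horner_exp hornerM !horner1_qint hornerXn expr1n mulr1.
  by rewrite -natrM -exprS natz.
(* The power sum supplies 2m+1 factors 1 - q, and the definition of [cleared] one more. *)
- exists ((\prod_(j < m.+1) qint (m.+1 - j)) * \sum_(1 <= j < n.+2)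
      qint (2 * j) * qint j ^+ (2 * m) * 'X^(m.+1 * (n.+1 - j))).
  apply: emb_inj.
  transitivity ((1 - q) * (\prod_(j < m.+1) emb (qint (m.+1 - j))) * \sum_(s < m.+1)
     fcoef q m s * ((1 - q ^+ n.+1) * (1 - q ^+ n.+2)) ^+ (m.+1 - s) * q ^+ (s * n.+1)).
    rewrite rmorph_sum mulr_sumr (reindex_inj rev_ord_inj); apply: eq_bigr => i _ /=.
    have le_i : (i <= m)%N by rewrite -ltnS.
    rewrite /H /V /= !subSS subKn // subSn //.
    rewrite !rmorphM !rmorphXn /= rmorphM -GE // emb_one_subX !one_sub_emb_exp -/q /cleared.
    by rewrite [(1 - q) * emb _ * _]mulrACA -expr2 [((1 - q) ^+ 2 * _) ^+ _]exprMn -exprM; ring.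
  rewrite -(faulhaber_expand one_sub_emb_exp_neq0) !rmorphM rmorphXn emb_one_subX.
  rewrite rmorph_prod rmorph_sum -mulrA mulrCA [RHS]mulrCA; congr (_ * _).
  rewrite !mulr_sumr; apply: eq_bigr => j _.
  rewrite !rmorphM !rmorphXn /= -/q !one_sub_emb_exp mulnS [(2 * m)%N]mulnC !exprD exprMn.
  by ring.
rewrite /H inordK; last by rewrite ltnS leq_subr.
rewrite subKn // => HE; exists r.
apply: (mulIf (expf_neq0 (2 * (m - s).+1) one_subX_neq0)).
by rewrite HE mulrAC -exprD; congr (_ ^+ _ * _); lia.
Qed.

(** Multiplied by the remaining q-integers [D], the left side becomes (1 - q)^s [cleared m s], which
    is divisible by (1 - q)^(s+2s); [D] does not vanish at 1 and can be cancelled. *)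
Lemma fcoef_integral m s : (s <= m)%N ->
  exists p, (\prod_(j < s.+1) (1 - q ^+ (m.+1 - j))) * fcoef q m s = (1 - q) ^+ (3 * s) * emb p.
Proof.
move=> le_sm; have [w wE] := isq_numerator le_sm.
have [G GE] : exists G : 'I_m.+1 -> {poly int}, forall s : 'I_m.+1, cleared m s = emb (G s).
  apply: (fin_all_exists (P := fun (i : 'I_m.+1) p => cleared m i = emb p)) => i.
  by apply: isq_cleared; rewrite -ltnS.
have [] := @cleared_dvd m (fun s => G (inord s)) _ s le_sm.
  by move=> i le_im; rewrite -GE inordK.
move=> g gE; set D := \prod_(s.+1 <= j < m.+1) qint (m.+1 - j).
have [||p pE] := @one_subX_exp_dvd_mul (3 * s) w D g.
- rewrite horner_prod prodf_seq_neq0; apply/allP => j; rewrite mem_index_iota => /andP[_ lt_j].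
  by rewrite horner1_qint pnatr_eq0 subn_eq0 -ltnNge.
- apply: emb_inj; rewrite (_ : (1 - 'X) ^+ (3 * s) = (1 - 'X) ^+ s * (1 - 'X) ^+ (2 * s)).
    rewrite -mulrA -gE 2!rmorphM -wE -GE inordK // rmorphXn /= emb_one_subX /cleared.
    rewrite /D rmorph_prod.
    rewrite (eq_bigr (fun j : 'I_s.+1 => (1 - q) * emb (qint (m.+1 - j)))); last first.
      by move=> j _; rewrite one_sub_emb_exp.
    rewrite big_split /= prodr_const card_ord exprS.
    rewrite -!(big_mkord xpredT (fun j => emb (qint (m.+1 - j)))).
    by rewrite [in RHS](big_cat_nat (n := s.+1)) //=; ring.
  by rewrite -exprD; congr (_ ^+ _); lia.
by exists p; rewrite wE pE rmorphM rmorphXn /= emb_one_subX.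
Qed.

End Integrality.

(** * Specialisation to [K], where q = t^2, and the theorem *)

Definition emb : {poly int} -> K := @FracField.tofrac {poly int} \o comp_poly 'X^2.
HB.instance Definition _ := GRing.RMorphism.on emb.

Lemma embE p : emb p = toK (p \Po 'X^2). Proof. by []. Qed.

Lemma embX : emb 'X = q.
Proof. by rewrite embE comp_polyX /toK tofracXn. Qed.

Lemma emb_inj : injective emb.
Proof.
apply: raddf_inj => p /=; rewrite embE => /eqP.
by rewrite /toK tofrac_eq0 comp_poly_eq0 ?size_polyXn // => /eqP.
Qed.

Lemma one_sub_expq_neq0 n : (0 < n)%N -> 1 - q ^+ n != 0.
Proof. by rewrite -embX; apply: one_sub_emb_exp_neq0 emb_inj _. Qed.

Lemma one_subq_neq0 : 1 - q != 0.
Proof. exact: (@one_sub_expq_neq0 1). Qed.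

Lemma natrK_neq0 n : n.+1%:R != 0 :> K.
Proof.
rewrite -(rmorph_nat emb) -(rmorph0 emb) (inj_eq emb_inj).
by rewrite -polyC_natr polyC_eq0 pnatr_eq0.
Qed.

Lemma mulf_cancel_denoms (F : fieldType) (a b c d e : F) : c != 0 -> e != 0 ->
  a / c * (b / e) * d * (c * e) = a * b * d.
Proof. by move=> c0 e0; field; rewrite c0 e0. Qed.

(** Used with e = (-1)^k, w the product of the 1 - q^(m+1-i), h = (1 - q)^(3k), d = 1 - q^2 and a =
    (1 - q)^(2m). *)
Lemma faulhaber_term (F : fieldType) (e w h f y d a : F) :
    w != 0 -> h != 0 -> d != 0 -> a != 0 ->
  e * (w / h * (e * f)) * y / (d * (a / h) * w) * (d * a) = e * e * (f * y).
Proof. by move=> w0 h0 d0 a0; field; rewrite w0 h0 d0 a0. Qed.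

Lemma S_expand m n :
  S (2 * m + 1) n * ((1 - q ^+ 2) * (1 - q) ^+ (2 * m)) =
  \sum_(s < m.+1) fcoef q m s * ((1 - q ^+ n) * (1 - q ^+ n.+1)) ^+ (m.+1 - s) * q ^+ (s * n).
Proof.
rewrite -(faulhaber_expand one_sub_expq_neq0) /S mulr_suml; apply: eq_bigr => j _.
have -> : qh ^+ ((2 * m + 1 + 1) * (n - j)) = q ^+ (m.+1 * (n - j)).
  by rewrite /q -exprM mulnA; congr (_ ^+ (_ * _)); lia.
rewrite addnK expr_div_n; apply: mulf_cancel_denoms; first exact: one_sub_expq_neq0.
exact: expf_neq0 one_subq_neq0.
Qed.

Lemma P_fcoef m s : (s <= m)%N ->
  P m s = \prod_(0 <= j < s.+1) (1 - q ^+ (m + 1 - j)) / (1 - q) ^+ (3 * s)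
          * ((-1) ^+ s * fcoef q m s).
Proof.
move=> le_sm; rewrite /P; congr (_ * _).
rewrite big_mkord /fcoef mulr_sumr; apply: eq_bigr => k _.
have le_ks : (k <= s)%N by rewrite -ltnS.
have -> : \sum_(0 <= i < (s - k).+1) ((m - k + 1)%:R / (m - s + 1)%:R * ('C(m - s + i, i))%:R
    * ('C(m - k - i, s - k - i))%:R * q ^+ (s - k - i)) = acoef q (m.+1 - s) (s - k) :> K.
  (* Multiplying by m-s+1, nonzero in characteristic 0, brings [acoef] into the form of
     [acoef_scale]. *)
  rewrite big_mkord subSn // addn1; apply: (mulfI (natrK_neq0 (m - s))).
  rewrite acoef_scale mulr_sumr; apply: eq_bigr => i _.
  have -> : (m - s + (s - k) - i = m - k - i)%N by lia.
  rewrite (_ : (m - s).+1 + (s - k) = m - k + 1)%N; last by lia.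
  by rewrite !addn1 !natrM -!mulrA mulrCA (mulVKf (natrK_neq0 _)).
have -> : (-1) ^+ (s - k) = (-1) ^+ s * (-1) ^+ k :> K.
  rewrite -exprD (_ : s + k = s - k + 2 * k)%N; last by lia.
  by rewrite exprD exprM sqrrN !expr1n mulr1.
by rewrite addn1 -/(ccoef K m k) -!mulrA; congr (_ * (_ * _)); rewrite mulrCA.
Qed.

Theorem theorem1p1 (m n : nat) (hn : (1 <= n)%N) :
  (forall s : nat, (s <= m)%N ->
     exists p : {poly int}, P m s = toK (p \Po 'X^2))
  /\
  S (2 * m + 1) n =
    \sum_(0 <= k < m.+1)
      ((-1) ^+ k * P m k
       * ((1 - q ^+ n) ^+ (m + 1 - k) * (1 - q ^+ n.+1) ^+ (m + 1 - k)
          * q ^+ (k * n))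
       / ((1 - q ^+ 2) * (1 - q) ^ ((2 * m)%:Z - (3 * k)%:Z)
          * \prod_(0 <= i < k.+1) (1 - q ^+ (m + 1 - i)))).
Proof.
have q2_neq0 : 1 - q ^+ 2 != 0 by apply: one_sub_expq_neq0.
have den_neq0 : (1 - q ^+ 2) * (1 - q) ^+ (2 * m) != 0.
  exact: mulf_neq0 q2_neq0 (expf_neq0 _ one_subq_neq0).
split=> [s le_sm|].
  have [p] := fcoef_integral emb_inj le_sm; rewrite /= embX => pE.
  exists ((-1) ^+ s * p); rewrite -embE rmorphM rmorphXn /= rmorphN1 P_fcoef //.
  rewrite big_mkord addn1 mulrCA; congr (_ * _); rewrite mulrAC pE.
  by rewrite mulrC (mulKf (expf_neq0 _ one_subq_neq0)).
apply: (mulIf den_neq0); rewrite S_expand big_mkord mulr_suml; apply: eq_bigr => k _.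
have le_km : (k <= m)%N by rewrite -ltnS.
have prod_neq0 : \prod_(i < k.+1) (1 - q ^+ (m.+1 - i)) != 0.
  apply/prodf_neq0 => i _; apply: one_sub_expq_neq0.
  by rewrite subn_gt0 ltnS (leq_trans _ le_km) // -ltnS.
(* The exponent 2m-3k may be negative; the power is split into (1 - q)^(2m) over (1 - q)^(3k). *)
rewrite P_fcoef // addn1 (expfzDr _ _ one_subq_neq0) -exprnN.
rewrite big_mkord -exprnP.
have h_neq0 j := expf_neq0 j one_subq_neq0.
rewrite (faulhaber_term _ _ _ prod_neq0 (h_neq0 _) q2_neq0 (h_neq0 _)).
by rewrite -expr2 sqrr_sign mul1r exprMn !mulrA.
Qed.
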